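(* Let $\tau\in\zeta(d)$, $\lambda=1/(k+\Phi)$ and $\eta=1-k\lambda$ for some integer $k\ge1$. There is a non-empty open set $\mathcal{A}\subseteq\mathbb{A}\cap\mathcal{R}(\tau)$ such that for all $\alpha\in\mathcal{A}$, $F$ has infinitely many horizontal periodic islands accumulating on the real line.
   Context: $\Phi=(\sqrt5-1)/2$. TCEs: let $d\geq 2$, $\mathbb{A}=\{\alpha\in\mathbb{R}_+^d: 0<\sum_{j=1}^d\alpha_j<\pi\}$, $|\alpha|=\sum_j\alpha_j$, $\beta=\frac{\pi}{2}-\frac{|\alpha|}{2}$, $\mathbb{H}=\{z\in\mathbb{C}:\mathrm{Im}(z)>0\}$. Put $W_0=[0,\beta)$, $W_1=[\beta,\beta+\alpha_1]$, $W_j=(\beta+\sum_{i=1}^{j-1}\alpha_i,\ \beta+\sum_{i=1}^{j}\alpha_i]$ for $2\leq j\leq d$, $W_{d+1}=(\pi-\beta,\pi]$, and $P_j=\{z\in\mathbb{H}:\arg(z)\in W_j\}$. For $\tau\in S(d)$ let $\theta_j=\sum_{\tau(i)<\tau(j)}\alpha_i-\sum_{i<j}\alpha_i$. Let $E(z)=z$ on $P_0\cup P_{d+1}$, $E(z)=ze^{i\theta_j}$ on $P_j$, $1\le j\le d$; for $\lambda\in\mathbb{R}^+\setminus\mathbb{Q}$, $0<\eta<\lambda$, let $G(z)=z-1$ on $P_0$, $G(z)=z-\eta$ on $P_1\cup\dots\cup P_d$, $G(z)=z+\lambda$ on $P_{d+1}$, and $F=G\circ E:\mathbb{H}\to\mathbb{H}$.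 $\mathcal{R}(\tau)$ is the set of all $\alpha\in\mathbb{A}$ such that for some $j\in\{1,\dots,d\}$ $$\Big|\sum_{\tau(i)>\tau(j)}\alpha_i-\sum_{i<j}\alpha_i\Big|<\alpha_j.\qquad( * )$$ $J_{\mathcal{R}}(\tau)$ is the set of all $j\in\{1,\dots,d\}$ such that $( * )$ holds for some $\alpha\in\mathbb{A}$. $\zeta_-(d)$ (resp. $\zeta_+(d)$) is the set of all $\tau\in S(d)$ such that there are $j'\in J_{\mathcal{R}}(\tau)$ and $j''\in\{1,\dots,d\}$ with $j'<j''$ and $\tau(j'')<\tau(j')$ (resp. $j'>j''$ and $\tau(j'')>\tau(j')$), and $\zeta(d)=\zeta_-(d)\cup\zeta_+(d)$. A horizontal periodic orbit of $F$ of height $h$ is a periodic orbit all of whose points have imaginary part $h$. A periodic island is a set $\bigcup_{r=0}^{m-1}B_\epsilon(F^r(p))$, where $p$ is a periodic point of period $m$ and $\epsilon>0$, such that for each $r$ all points of the open disc $B_\epsilon(F^r(p))$ have the same itinerary as $F^r(p)$ with respect to $\{P_0,\dots,P_{d+1}\}$ and, for each $0<\delta<\epsilon$, the union of circles $\bigcup_{r=0}^{m-1}\{z:|z-F^r(p)|=\delta\}$ is invariant under $F$. A horizontal periodic island is a periodic island that contains a horizontal periodic orbit. ''Infinitely many horizontal periodic islands accumulating on the real line'' means that there are infinitely many such islands, containing horizontal periodic orbits whose heights form a sequence converging to $0$. *)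

(* Defs.v *)
From mathcomp Require Export all_boot all_order all_algebra all_fingroup.
From mathcomp Require Export all_classical all_reals all_analysis.
From mathcomp Require Export complex.

Set Implicit Arguments.
Unset Strict Implicit.
Unset Printing Implicit Defensive.

Import Order.TTheory GRing.Theory Num.Theory.
Export numFieldNormedType.Exports.
Import ComplexField.Normc.

Local Open Scope classical_set_scope.
Local Open Scope ring_scope.
Local Open Scope complex_scope.

Section Plane.
Variable R : realType.

Definition golden : R := (Num.sqrt 5 - 1) / 2.

Definition half_plane : set R[i] := [set z | 0 < complex.Im z].

Definition expi (t : R) : R[i] := cos t +i* sin t.

(* The principal argument on the upper half-plane, where it takes its values in
   ]0, pi[ (see [half_plane_polar] and [half_plane_arg] below); it is only used
   there. *)
Definition arg (z : R[i]) : R := acos (complex.Re z / normc z).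

Lemma half_plane_bound (z : R[i]) : half_plane z ->
  0 < normc z /\ -1 < complex.Re z / normc z < 1.
Proof.
case: z => a b; rewrite /half_plane /= => b0.
have s0 : 0 < Num.sqrt (a ^+ 2 + b ^+ 2).
  by rewrite sqrtr_gt0 ltr_wpDl ?sqr_ge0 ?exprn_gt0.
split=> //; rewrite -ltr_norml normrM normfV (gtr0_norm s0).
rewrite ltr_pdivrMr // mul1r -sqrtr_sqr ltr_sqrt.
  by rewrite ltrDl exprn_gt0.
by rewrite ltr_wpDl ?sqr_ge0 ?exprn_gt0.
Qed.

Lemma half_plane_arg (z : R[i]) : half_plane z -> 0 < arg z < pi.
Proof.
move=> /half_plane_bound[_ /andP[z1 z2]].
by rewrite acos_gt0 ?acos_ltpi // ?z1 ?z2 ltW.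
Qed.

Lemma half_plane_polar (z : R[i]) : half_plane z ->
  z = (normc z)%:C * expi (arg z).
Proof.
move=> Hz; have [n0 /andP[z1 z2]] := half_plane_bound Hz.
rewrite /expi /arg sin_acos ?acosK ?in_itv/= ?(ltW z1) ?(ltW z2) //.
case: z Hz n0 z1 z2 => a b; rewrite /half_plane /= => b0.
set s := Num.sqrt _ => n0 _ _.
have s2 : s ^+ 2 = a ^+ 2 + b ^+ 2 by rewrite sqr_sqrtr // addr_ge0 ?sqr_ge0.
have sN0 : s != 0 by rewrite gt_eqF.
have -> : 1 - (a / s) ^+ 2 = (b / s) ^+ 2.
  rewrite !expr_div_n; apply: (mulIf (expf_neq0 2 sN0)).
  by rewrite mulrBl !divfK ?expf_neq0 // mul1r s2 addrC addKr.
rewrite sqrtr_sqr gtr0_norm ?divr_gt0 // /GRing.mul /= !mul0r subr0 addr0.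
by rewrite ![s * _]mulrC !divfK.
Qed.

Definition disc (p : R[i]) (e : R) : set R[i] := [set z | normc (z - p) < e].
Definition circle (p : R[i]) (e : R) : set R[i] := [set z | normc (z - p) = e].

End Plane.

Section TranslatedConeExchange.
Variables (R : realType) (d : nat).
Implicit Types (alpha : 'rV[R]_d) (tau : 'S_d).

(* The entries alpha_1, ..., alpha_d and the permuted symbols 1, ..., d are
   indexed from 0, so that (j : 'I_d) stands for the symbol j + 1. *)

Definition total alpha : R := \sum_(i < d) alpha 0 i.

Definition cone_angles : set 'rV[R]_d :=
  [set alpha : 'rV[R]_d | (forall i, 0 < alpha 0 i) /\ 0 < total alpha < pi].

Definition beta alpha : R := pi / 2 - total alpha / 2.

Definition cone_end alpha (j : nat) : R :=
  beta alpha + \sum_(i < d | (i < j)%N) alpha 0 i.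

(* The interval W_j, meant for 0 <= j <= d + 1. *)
Definition sector alpha (j : nat) : set R :=
  if j == 0%N then `[0, beta alpha[%classic
  else if j == 1%N then `[cone_end alpha 0%N, cone_end alpha 1%N]%classic
  else if (j <= d)%N then `]cone_end alpha j.-1, cone_end alpha j]%classic
  else `](pi - beta alpha), pi]%classic.

Definition cone alpha (j : nat) : set R[i] :=
  @half_plane R `&` [set z | sector alpha j (arg z)].

Definition theta alpha tau (j : 'I_d) : R :=
  \sum_(i < d | (tau i < tau j)%N) alpha 0 i - \sum_(i < d | (i < j)%N) alpha 0 i.

(* The middle cones are pairwise disjoint, so that there is at most one j to
   pick; there is none in the two outer cones. *)
Definition exchange alpha tau (z : R[i]) : R[i] :=
  if [pick j : 'I_d | `[< cone alpha j.+1 z >]] is Some j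
  then z * expi (theta alpha tau j) else z.

(* Inside the half-plane, the last case is that of the middle cones; the value
   outside the half-plane is irrelevant. *)
Definition translation alpha (lambda eta : R) (z : R[i]) : R[i] :=
  if `[< cone alpha 0%N z >] then z - 1
  else if `[< cone alpha d.+1 z >] then z + lambda%:C
  else z - eta%:C.

Definition TCE alpha tau (lambda eta : R) (z : R[i]) : R[i] :=
  translation alpha lambda eta (exchange alpha tau z).

Definition reflective_at alpha tau (j : 'I_d) : Prop :=
  `|\sum_(i < d | (tau i > tau j)%N) alpha 0 i
     - \sum_(i < d | (i < j)%N) alpha 0 i| < alpha 0 j.

Definition reflective tau : set 'rV[R]_d :=
  [set alpha : 'rV[R]_d | cone_angles alpha /\ exists j, reflective_at alpha tau j].

Definition reflective_indices tau : set 'I_d :=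
  [set j : 'I_d | exists2 alpha : 'rV[R]_d, cone_angles alpha & reflective_at alpha tau j].

Definition zeta_minus : set 'S_d :=
  [set tau : 'S_d | exists j' j'' : 'I_d,
    [/\ reflective_indices tau j', (j' < j'')%N & (tau j'' < tau j')%N]].

Definition zeta_plus : set 'S_d :=
  [set tau : 'S_d | exists j' j'' : 'I_d,
    [/\ reflective_indices tau j', (j' > j'')%N & (tau j'' > tau j')%N]].

Definition zeta : set 'S_d := zeta_minus `|` zeta_plus.

Definition same_itinerary alpha (f : R[i] -> R[i]) (z w : R[i]) : Prop :=
  forall (n : nat) (j : 'I_d.+2),
    cone alpha j (iter n f z) <-> cone alpha j (iter n f w).

End TranslatedConeExchange.

Section Islands.
Variables (R : realType) (f : R[i] -> R[i]).

(* m is the least period of p *)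
Definition periodic_point (m : nat) (p : R[i]) : Prop :=
  [/\ half_plane p, (0 < m)%N, iter m f p = p &
      forall k, (0 < k < m)%N -> iter k f p <> p].

Definition periodic_orbit (O : set R[i]) : Prop :=
  exists m p, periodic_point m p /\ O = [set iter r f p | r in `I_m].

Definition horizontal_periodic_orbit (h : R) (O : set R[i]) : Prop :=
  periodic_orbit O /\ forall z, O z -> complex.Im z = h.

Definition periodic_island d (alpha : 'rV[R]_d) (I : set R[i]) : Prop :=
  exists m p e,
    [/\ periodic_point m p, 0 < e,
        forall r, (r < m)%N -> forall z, disc (iter r f p) e z ->
          same_itinerary alpha f z (iter r f p),
        forall delta, 0 < delta < e ->
          let C := \bigcup_(r in `I_m) circle (iter r f p) delta in f @` C = C
      & I = \bigcup_(r in `I_m) disc (iter r f p) e].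

Definition horizontal_islands_cluster_at_real_line d (alpha : 'rV[R]_d) : Prop :=
  exists (I O : nat -> set R[i]) (h : nat -> R),
    [/\ injective I,
        forall n, periodic_island alpha (I n),
        forall n, horizontal_periodic_orbit (h n) (O n),
        forall n, O n `<=` I n
      & h n @[n --> \oo] --> (0 : R)].

End Islands.

(* Main.v *)
Require Import Defs.
From mathcomp Require Import ring lra zify.
Import Order.TTheory GRing.Theory Num.Theory.
Import ComplexField.Normc.

(** Fix a symbol [j] and write [y = theta_j / 2].  The map rotates the cone of
    [j] by [2 y], so among the points of height [h] in that cone it sends
    [h tan y + i h] to its mirror image [- h tan y + i h] before translating by
    [- eta]; being reflective at [j] says that this point is interior to the
    cone.  Everywhere outside the middle cones a point of height [h] just moves
    by [lambda] to the right or by [1] to the left.  So a horizontal periodic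
    orbit appears as soon as the rotation started at [- h tan y - eta] reaches
    [h tan y] without having met the middle cones, which at height [h] cover
    [|x| <= h tan (total / 2)].

    In the unit [lambda] one has [eta = Phi] and [1 = k + Phi], and the points of
    the rotation are [n - q Phi - T] with [T = h tan y / lambda].  The target
    [T] is hit when [2 T = N - Q Phi]; taking for [N / Q] a quotient of
    consecutive Fibonacci numbers gives [2 T = (- Phi) ^ m], so the heights tend
    to [0], and the parity of [m] can be chosen to make [T] and [y] of the same
    sign.  Since the determinant of consecutive convergents is [1] or [-1],
    every other point [n - q Phi - T] with [0 < q <= Q] is at distance at least
    [(1 + 2 / Phi) |T| > 4 |T|] from [0] ([golden_gap]).  It remains to have
    [tan (total / 2) <= 4 |tan y|], which holds when [total < pi / 2] and
    [total < 2 |theta_j|] ([half_angle_domination]).  These open conditions are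
    compatible with being reflective at [j] as soon as some [j'] changes its
    position with respect to [j] under [tau]: give [j'] most of the total angle
    and [j] most of the rest ([admissible_nonempty]).

    Finally the orbit stays away from the boundaries of the cones, so near each
    of its points the map is a Euclidean isometry of discs onto discs that does
    not change the cone; such an orbit is the set of centres of a periodic
    island ([periodic_island_of_rigid]). *)

Set Implicit Arguments.
Unset Strict Implicit.
Unset Printing Implicit Defensive.
Local Open Scope classical_set_scope.
Local Open Scope ring_scope.
Local Open Scope complex_scope.

(** * Approximation by multiples of the golden mean *)

Section Golden.
Variable R : realType.
Notation Phi := (golden R).

Lemma golden_bounds : 1 / 2 < Phi < 2 / 3.
Proof.
have s2 : Num.sqrt 5 ^+ 2 = 5 :> R by rewrite sqr_sqrtr.
have s0 : 0 <= Num.sqrt (5 : R) by exact: sqrtr_ge0.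
by rewrite /golden; apply/andP; split; nra.
Qed.

Lemma golden_sqr : Phi * Phi = 1 - Phi.
Proof.
have s2 : Num.sqrt 5 ^+ 2 = 5 :> R by rewrite sqr_sqrtr.
by rewrite /golden; field: s2.
Qed.

Fixpoint fib (n : nat) : nat :=
  if n is (m.+1 as n').+1 then (fib m + fib n')%N else n.

Lemma fibSS n : fib n.+2 = (fib n + fib n.+1)%N. Proof. by []. Qed.

Lemma fibS_gt0 n : (0 < fib n.+1)%N.
Proof. by elim: n => // n IH; rewrite fibSS addn_gt0 IH orbT. Qed.

Lemma fib_golden n :
  (fib n)%:R - (fib n.+1)%:R * Phi = (- Phi) ^+ n.+1 :> R.
Proof.
elim: n => [|n IH]; first by rewrite /= sub0r mul1r expr1.
rewrite exprS -IH fibSS natrD.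
have e := golden_sqr; ring: e.
Qed.

(** The square spares the sign of the determinant, which alternates. *)
Lemma cassini n :
  ((fib n)%:Z * (fib n)%:Z + (fib n)%:Z * (fib n.+1)%:Z
     - (fib n.+1)%:Z * (fib n.+1)%:Z) ^+ 2 = 1 :> int.
Proof.
elim: n => [//|n <-]; rewrite fibSS PoszD; ring.
Qed.

(** Unimodularity lets [(n, q)] be written [x (N, Q) + y (Q - N, N)], where the
    second vector is the previous convergent, with value [- 2 T / Phi].  The
    bound [0 < q <= Q] forces [x <= 0 < y] or [y < 0 < x] unless
    [(n, q) = (N, Q)], so that the two contributions add up. *)
Lemma golden_gap (N Q q : nat) (n : int) :
  let s : int := N%:Z * N%:Z + N%:Z * Q%:Z - Q%:Z * Q%:Z in
  let T : R := (N%:R - Q%:R * Phi) / 2 in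
  s ^+ 2 = 1 -> (0 < q <= Q)%N -> (0 < N)%N -> (n, q) != (N%:Z, Q) -> T != 0 ->
  4 * `|T| < `|n%:~R - q%:R * Phi - T|.
Proof.
move=> s T s1 qQ N0 nq T0.
have /andP[P1 P2] := golden_bounds; have PP := golden_sqr.
(* Cramer's rule for the decomposition, the determinant [s] being its own inverse. *)
pose x : int := s * (n * N%:Z - q%:Z * (Q%:Z - N%:Z)).
pose y : int := s * (q%:Z * N%:Z - n * Q%:Z).
have nE : n = x * N%:Z + y * (Q%:Z - N%:Z).
  rewrite -[LHS]mul1r -s1 /x /y /s; ring.
have qE : q%:Z = x * Q%:Z + y * N%:Z.
  rewrite -[LHS]mul1r -s1 /x /y /s; ring.
have XE : (n%:~R - q%:R * Phi - T) * Phi = T * ((2 * x%:~R - 1) * Phi - 2 * y%:~R).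
  have -> : q%:R = (q%:Z)%:~R :> R by [].
  rewrite qE nE !(rmorphD, rmorphM, rmorphN) /= /T; by field: PP.
clearbody T; have P0 : 0 < Phi by lra.
suff : 4 * Phi < `|(2 * x%:~R - 1) * Phi - 2 * y%:~R|.
  move=> lt; rewrite -(ltr_pM2r P0) -[X in _ < _ * X](gtr0_norm P0) -normrM XE normrM.
  by rewrite (mulrC 4) -mulrA ltr_pM2l ?normr_gt0.
clear XE; have [y0|y0|y0] := ltgtP y 0.
- have x1 : 0 < x * Q%:Z.
    have yN : y * N%:Z < 0 by rewrite pmulr_llt0.
    by clear -qE yN qQ; lia.
  have Q0 : 0 < Q%:Z by clear -qQ; lia.
  rewrite (pmulr_lgt0 _ Q0) in x1.
  have y1 : y <= -1 by clear -y0; lia.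
  have x1' : (1 : R) <= x%:~R by rewrite (ler_int _ 1) -gtz0_ge1.
  have y1' : y%:~R <= (-1 : R) by rewrite (ler_int _ _ (-1)).
  rewrite ger0_norm; nra.
- have x1 : x <= 0.
    have yN : 0 < y * N%:Z by rewrite mulr_gt0.
    rewrite leNgt; apply/negP => x0.
    have : Q%:Z <= x * Q%:Z by rewrite ler_peMl // -gtz0_ge1.
    by clear -qE yN qQ; lia.
  have y1 : 1 <= y by clear -y0; lia.
  have x1' : x%:~R <= (0 : R) by rewrite (ler_int _ _ 0).
  have y1' : (1 : R) <= y%:~R by rewrite (ler_int _ 1).
  rewrite ler0_norm; nra.
- exfalso; have x1 : x = 1.
    rewrite y0 mul0r addr0 in qE.
    have Q0 : 0 < Q%:Z by clear -qQ; lia.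
    have x0 : 0 < x by rewrite -(pmulr_lgt0 _ Q0) -qE; clear -qQ; lia.
    apply/eqP; rewrite eq_le -[1 <= x]gtz0_ge1 x0 andbT -(ler_pM2r Q0) -qE mul1r.
    by clear -qQ; lia.
  move: nq; rewrite xpair_eqE nE; have -> : q = Q.
    by move: qE; rewrite x1 y0 mul1r mul0r addr0 => -[].
  by rewrite x1 y0 mul1r mul0r addr0 !eqxx.
Qed.

End Golden.

(** * Return times of the horizontal rotation *)

Section Rotation.
Variables (R : realType) (k : nat).
Notation Phi := (golden R).

(** The horizontal motion in the two outer cones, in the unit [lambda]. *)
Definition rotation (X : R) : R := if X < 0 then X + 1 else X - (k%:R + Phi).

Lemma rotation_climb (X : R) (r : nat) :
  (forall i, (i < r)%N -> X + i%:R < 0) ->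
  forall i, (i <= r)%N -> iter i rotation X = X + i%:R.
Proof.
move=> Xr; elim=> [|i IH] ir; first by rewrite addr0.
rewrite iterS (IH (ltnW ir)) /rotation (Xr i ir) -addrA; congr (_ + _).
by rewrite -natr1.
Qed.

Lemma first_nonneg (X : R) : X < 0 ->
  exists r : nat, [/\ 0 <= X + r%:R, X + r%:R < 1 &
    forall i, (i < r)%N -> X + i%:R < 0].
Proof.
move=> X0.
have ex : exists r : nat, 0 <= X + r%:R.
  exists (Num.bound (- X)).
  by rewrite -lerBlDl sub0r ltW // archi_boundP // oppr_ge0 ltW.
case: (ex_minnP ex) => r r0 rmin; exists r; split=> // [|i ir].
- case: r r0 rmin => [|r] r0 rmin; first by move: r0; rewrite addr0 leNgt X0.
  rewrite -natr1 addrA -ltrBrDr subrr ltNge; apply/negP => /rmin.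
  by rewrite ltnn.
- by rewrite ltNge; apply/negP => /rmin; rewrite leqNgt ir.
Qed.

(** By induction on [q], the orbit meets a point [n - q Phi - T] on the left of
    both [0] and [T] for each [q] up to [Q]: from such a point it climbs by unit
    steps to a number at least [0] and less than [1], and then falls by
    [k + Phi >= 1 + Phi].  At [q = Q] the points of the climb are [T] minus an
    integer, hence negative until [T] is hit. *)
Lemma rotation_return (N Q : nat) (T M : R) :
  (0 < k)%N -> (0 < Q)%N -> T = (N%:R - Q%:R * Phi) / 2 ->
  - Phi < 2 * T < Phi -> 0 <= M ->
  (forall (n : int) (q : nat), (0 < q <= Q)%N -> (n, q) != (N%:Z, Q) ->
     M < `|n%:~R - q%:R * Phi - T|) ->
  exists s, iter s rotation (- Phi - T) = T /\
    forall i, (i < s)%N -> M < `|iter i rotation (- Phi - T)|.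
Proof.
move=> k0 Q0 TE /andP[T1 T2] M0 gap; have /andP[P1 P2] := golden_bounds R.
have k1 : 1 <= k%:R :> R by rewrite ler1n.
set x0 := - Phi - T.
pose pos (n : int) (q : nat) : R := n%:~R - q%:R * Phi - T.
have posD n q i : pos n q + i%:R = pos (n + i%:Z) q.
  by rewrite /pos rmorphD /= -pmulrn; ring.
have posT : pos N%:Z Q = T by rewrite /pos -pmulrn TE; field.
have posTn n : pos n Q = T + (n%:~R - N%:R).
  by rewrite -posT /pos -pmulrn; ring.
have posTlt n : pos n Q < T -> n < N%:Z.
  rewrite posTn -subr_gt0 opprD addrA subrr sub0r opprB subr_gt0.
  by rewrite pmulrn ltr_int.
have iterD a b : iter (a + b) rotation x0 = iter a rotation (iter b rotation x0).
  by rewrite iterD.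
have main q : (0 < q <= Q)%N -> exists s n,
    [/\ iter s rotation x0 = pos n q, pos n q < 0, pos n q < T &
        forall i, (i < s)%N -> M < `|iter i rotation x0|].
  elim: q => [//|q IH] /andP[_ qQ]; have [->|q0] := posnP q.
    exists 0%N, 0; split=> //=; rewrite /pos/x0; lra.
  have [|s [n [sn n0 nT sM]]] := IH; first by rewrite q0 ltnW.
  have [r [r0 r1 rlt]] := first_nonneg n0.
  have climb := rotation_climb rlt.
  have good (m : int) : M < `|pos m q|.
    by apply: gap; [rewrite q0 ltnW | rewrite xpair_eqE (ltn_eqF qQ) andbF].
  have sr : iter (r.+1 + s) rotation x0 = pos (n + r%:Z - k%:Z) q.+1.
    rewrite iterD sn iterS climb // /rotation ltNge r0 /= posD /pos.
    by rewrite !rmorphD rmorphN /= -!pmulrn -natr1; ring.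
  have lt : pos (n + r%:Z - k%:Z) q.+1 < - Phi.
    have -> : pos (n + r%:Z - k%:Z) q.+1 = pos n q + r%:R - (k%:R + Phi).
      by rewrite /pos !rmorphD rmorphN /= -!pmulrn -natr1; ring.
    lra.
  exists (r.+1 + s)%N, (n + r%:Z - k%:Z); split=> //; try lra.
  move=> i; have [/sM //|si] := ltnP i s.
  rewrite -{1}(subnK si) ltn_add2r ltnS => ir.
  by rewrite -(subnK si) iterD sn climb // posD good.
have [|s [n [sn n0 nT sM]]] := main Q; first by rewrite Q0 leqnn.
have /posTlt nN := nT.
pose r := `|N%:Z - n|%N.
have rE : r%:Z = N%:Z - n by rewrite /r gez0_abs // subr_ge0 ltW.
have climb : forall i, (i <= r)%N -> iter i rotation (pos n Q) = pos n Q + i%:R.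
  apply: rotation_climb => i ir; rewrite posD posTn.
  have : n + i%:Z + 1 <= N%:Z by lia.
  rewrite -(ler_int R) !rmorphD /= -!pmulrn; lra.
exists (r + s)%N; split.
  by rewrite iterD sn climb // posD rE addrC subrK posT.
move=> i; have [/sM //|si] := ltnP i s.
rewrite -{1}(subnK si) ltn_add2r => ir.
rewrite -(subnK si) iterD sn climb 1?ltnW // posD gap ?Q0 ?leqnn //.
rewrite xpair_eqE eqxx andbT; apply/eqP; lia.
Qed.

End Rotation.

(** * Islands around orbits of local isometries *)

Section Rigid.
Variables (R : realType) (d : nat) (alpha : 'rV[R]_d) (f : R[i] -> R[i]).

(** Near [p] the map is a rotation about [p] followed by a translation, and no
    boundary between cones is met. *)
Definition rigid_at (e : R) (p : R[i]) : Prop := exists2 u : R[i], normc u = 1 &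
  forall z, disc p e z ->
    (forall j : 'I_d.+2, cone alpha j z <-> cone alpha j p) /\
    f z = f p + u * (z - p).

Lemma rigid_at_le (e e' : R) p : e <= e' -> rigid_at e' p -> rigid_at e p.
Proof. by move=> ee' [u u1 H]; exists u => // z zp; apply/H/(lt_le_trans zp). Qed.

Lemma iter_modn (m : nat) p r : iter m f p = p -> iter r f p = iter (r %% m) f p.
Proof.
move=> pm; rewrite {1}(divn_eq r m) addnC iterD; congr (iter _ f _).
by elim: (r %/ m)%N => // q IH; rewrite mulSn iterD IH.
Qed.

Lemma common_radius (P : nat -> R -> Prop) m :
  (forall r e e', e <= e' -> P r e' -> P r e) ->
  (forall r, (r < m)%N -> exists2 e, 0 < e & P r e) ->
  exists2 e, 0 < e & forall r, (r < m)%N -> P r e.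
Proof.
move=> Ple; elim: m => [|m IH] H; first by exists 1.
have [r rm|e e0 He] := IH; first by apply: H; rewrite ltnW.
have [e' e'0 He'] := H m (leqnn _).
exists (Num.min e e'); first by rewrite lt_min e0.
move=> r; rewrite ltnS leq_eqVlt => /orP[/eqP ->|rm].
  by apply: Ple He'; rewrite ge_min lexx orbT.
by apply: Ple (He r rm); rewrite ge_min lexx.
Qed.

(** A disc around a point of the orbit is carried isometrically onto the disc
    around the next point, so itineraries agree along the orbit, and circles
    around the points of the orbit are permuted cyclically. *)
Lemma periodic_island_of_rigid m p : periodic_point f m p ->
  (forall r, (r < m)%N -> exists2 e, 0 < e & rigid_at e (iter r f p)) ->
  exists2 e0, 0 < e0 & forall e, 0 < e <= e0 ->
    periodic_island f alpha (\bigcup_(r in `I_m) disc (iter r f p) e).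
Proof.
move=> perp rig; have [_ m0 pm _] := perp.
have [|e0 e00 He0] := common_radius _ rig.
  by move=> r e e'; exact: rigid_at_le.
exists e0 => // e /andP[e_gt0 ee0].
have {He0} rige r : rigid_at e (iter r f p).
  by rewrite (iter_modn r pm); apply/(rigid_at_le ee0)/He0/ltn_pmod.
have dist r z : disc (iter r f p) e z ->
    normc (f z - iter r.+1 f p) = normc (z - iter r f p).
  have [u u1 H] := rige r; move=> /H[_ ->].
  by rewrite iterS addrAC subrr add0r normcM u1 mul1r.
exists m, p, e; split=> //.
- move=> r rm z zr n j; rewrite -iterD.
  have zn : disc (iter (n + r) f p) e (iter n f z).
    by elim: n => // n IH; rewrite /disc /= (dist (n + r)%N).
  by have [u _ H] := rige (n + r)%N; apply: (H _ zn).1.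
- move=> delta /andP[de0 de] C; apply/seteqP; split=> [_ [z [r rm zr] <-]|z [r rm zr]].
    exists (r.+1 %% m)%N; first by rewrite /= ltn_pmod.
    by rewrite /circle /= -(iter_modn _ pm) dist // /disc /= zr.
  (* The predecessor of a point of the orbit; that of the first one is the last. *)
  have [s sm rE] : exists2 s, (s < m)%N & iter r f p = iter s.+1 f p.
    case: r rm {zr} => [|r] rm; first by exists m.-1; rewrite ?prednK // pm.
    by exists r => //; apply: ltn_trans rm.
  have [u u1 H] := rige s.
  have u0 : u != 0.
    by apply/eqP => u0; move: u1; rewrite u0 normc0 => /eqP; rewrite eq_sym oner_eq0.
  have dw : normc (u^-1 * (z - iter r f p)) = delta.
    by rewrite normcM normcV u1 invr1 mul1r.
  exists (iter s f p + u^-1 * (z - iter r f p)).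
    by exists s => //; rewrite /circle /= addrAC subrr add0r.
  rewrite (H _ _).2; last by rewrite /disc /= addrAC subrr add0r dw.
  by rewrite addrAC subrr add0r mulrA divff // mul1r -iterS -rE addrC subrK.
Qed.

End Rigid.

(** * Rays through the origin *)

Section Sides.
Variable R : realType.
Implicit Types (z w : R[i]) (g : R).

(** The signed distance from [z] to the line of argument [g], positive on its
    right.  Unlike the argument it is linear, hence Lipschitz, which gives
    explicit radii for discs that avoid the line. *)
Definition side g z : R := complex.Re z * sin g - complex.Im z * cos g.

Lemma sideB g z w : side g (z - w) = side g z - side g w.
Proof. by case: z w => [a b] [c e]; rewrite /side /=; ring. Qed.

(** Hence the sign of [side g] compares the argument with [g]. *)
Lemma side_polar g z : half_plane z -> side g z = normc z * sin (g - arg z).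
Proof.
move=> /half_plane_polar; set r := normc z; set t := arg z => ->.
by rewrite /side /= sinB; ring.
Qed.

Lemma side_gt0 g z : half_plane z -> 0 < g < pi -> (0 < side g z) = (arg z < g).
Proof.
move=> Hz /andP[g0 gpi]; have /andP[a0 api] := half_plane_arg Hz.
have [n0 _] := half_plane_bound Hz; rewrite side_polar // pmulr_rgt0 //.
have [ag|ag] := ltP (arg z) g.
  by apply: sin_gt0_pi; apply/andP; split; lra.
apply/negbTE; rewrite -leNgt -oppr_ge0 -sinN; apply: sin_ge0_pi.
by apply/andP; split; lra.
Qed.

Lemma side_lt0 g z : half_plane z -> 0 < g < pi -> (side g z < 0) = (g < arg z).
Proof.
move=> Hz /andP[g0 gpi]; have /andP[a0 api] := half_plane_arg Hz.
have [n0 _] := half_plane_bound Hz; rewrite side_polar // pmulr_rlt0 //.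
have [ag|ag] := ltP g (arg z).
  by rewrite -oppr_gt0 -sinN; apply: sin_gt0_pi; apply/andP; split; lra.
apply/negbTE; rewrite -leNgt; apply: sin_ge0_pi.
by apply/andP; split; lra.
Qed.

Lemma side_le g z : `|side g z| <= normc z.
Proof.
case: z => a b; rewrite /side /= -sqrtr_sqr ler_wsqrtr //.
have := cos2Dsin2 g; set c := cos g; set s := sin g => cs.
rewrite -subr_ge0 (_ : _ - _ = (a * c + b * s) ^+ 2) ?sqr_ge0 //.
by have -> : a ^+ 2 + b ^+ 2 = (a ^+ 2 + b ^+ 2) * (c ^+ 2 + s ^+ 2); [rewrite cs mulr1|ring].
Qed.

Lemma side_lip g z w : `|side g z - side g w| <= normc (z - w).
Proof. by rewrite -sideB side_le. Qed.

Lemma side0 z : side 0 z = - complex.Im z.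
Proof. by rewrite /side sin0 cos0; ring. Qed.

Lemma side_sign_disc g p z : disc p `|side g p| z ->
  (0 < side g z) = (0 < side g p) /\ (side g z < 0) = (side g p < 0).
Proof.
rewrite /disc /= => /(le_lt_trans (side_lip g z p)).
have [sp|sp|<-] := ltgtP 0 (side g p).
- rewrite (gtr0_norm sp) ltr_distl => /andP[h _].
  by rewrite subrr in h; rewrite h ltNge (ltW h).
- rewrite (ltr0_norm sp) ltr_distl => /andP[_ h].
  by rewrite subrr in h; rewrite h ltNge (ltW h).
- by rewrite normr0 ltNge normr_ge0.
Qed.

End Sides.

(** * Cones and the map on them *)

Section Cones.
Variables (R : realType) (d : nat) (alpha : 'rV[R]_d) (tau : 'S_d).
Variables (lambda eta : R).
Hypothesis d_gt0 : (0 < d)%N.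
Hypothesis alphaP : cone_angles alpha.
Notation gam := (cone_end alpha).
Notation F := (TCE alpha tau lambda eta).

Lemma beta_bounds : 0 < beta alpha < pi / 2.
Proof. by have [_ /andP[t0 tpi]] := alphaP; rewrite /beta; apply/andP; split; lra. Qed.

Lemma cone_end_mono i j : (i <= j)%N -> gam i <= gam j.
Proof.
move=> ij; rewrite lerD2l !(big_mkcond (fun l : 'I_d => (l < _)%N)) /=.
apply: ler_sum => l _; case: ifP => [li|_]; first by rewrite (leq_trans li ij).
by case: ifP => // _; apply/ltW/alphaP.1.
Qed.

Lemma cone_end0 : gam 0%N = beta alpha.
Proof. by rewrite /cone_end big_pred0_eq addr0. Qed.

Lemma cone_end_last i : (d <= i)%N -> gam i = pi - beta alpha.
Proof.
move=> di; rewrite /cone_end (eq_bigl xpredT) => [|l]; last first.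
  by rewrite (leq_trans (ltn_ord l) di).
by rewrite -/(total alpha) /beta; field.
Qed.

Lemma cone_end_bounds i : beta alpha <= gam i <= pi - beta alpha.
Proof.
rewrite -(cone_end_last (leq_maxr i d)) -cone_end0 cone_end_mono //=.
by rewrite cone_end_mono // leq_maxl.
Qed.

Lemma cone_end_in i : 0 < gam i < pi.
Proof.
have /andP[b0 _] := beta_bounds; have /andP[g1 g2] := cone_end_bounds i.
by apply/andP; split; lra.
Qed.

(** Strict comparisons with every end, on both sides, decide membership in open,
    closed and half-open sectors alike. *)
Lemma sector_eq (a b : R) j : 0 < a < pi -> 0 < b < pi ->
  (forall i, ((a < gam i) = (b < gam i)) /\ ((gam i < a) = (gam i < b))) ->
  sector alpha j a -> sector alpha j b.
Proof.
move=> /andP[a0 api] /andP[b0 bpi] H; rewrite /sector.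
rewrite -(cone_end_last (leqnn d)) -cone_end0.
have le i : (a <= gam i) = (b <= gam i) by rewrite !leNgt (H i).2.
have ge i : (gam i <= a) = (gam i <= b) by rewrite !leNgt (H i).1.
case: ifP => _ /=; first by rewrite !in_itv /= (H 0%N).1 (ltW b0) (ltW a0).
case: ifP => _ /=; first by rewrite !in_itv /= ge le.
case: ifP => _ /=; first by rewrite !in_itv /= (H _).2 le.
by rewrite !in_itv /= (H d).2 (ltW bpi) (ltW api).
Qed.

Lemma sector_bounds (j : 'I_d) a : sector alpha j.+1 a -> gam j <= a <= gam j.+1.
Proof.
rewrite /sector /= ltn_ord; case: ifP => [/eqP[->]|_] /=; rewrite in_itv //=.
by move=> /andP[/ltW -> ->].
Qed.

Lemma sector_in (j : 'I_d) a : gam j < a < gam j.+1 -> sector alpha j.+1 a.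
Proof.
move=> /andP[a1 a2]; rewrite /sector /= ltn_ord.
by case: ifP => [/eqP[<-]|_] /=; rewrite in_itv /= ?a1 (ltW a2) ?(ltW a1).
Qed.

(** A point on none of the rays that separate the cones has a disc around it
    inside its own cone.  The ray of argument [0] keeps the disc in the
    half-plane. *)
Lemma cone_disc w : half_plane w -> (forall i, side (gam i) w != 0) ->
  exists2 e, 0 < e & forall z, disc w e z ->
    half_plane z /\ forall j, cone alpha j z <-> cone alpha j w.
Proof.
move=> Hw offw.
(* All the ends of index at least [d] coincide, so finitely many rays are to be avoided. *)
have [|i _|e e0 He] := @common_radius R (fun i e => e <= `|side (gam i) w|) d.+1.
- by move=> r e e'; exact: le_trans.
- by exists `|side (gam i) w|; rewrite // normr_gt0.
exists (Num.min e `|side 0 w|).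
  by rewrite lt_min e0 normr_gt0 side0 oppr_eq0 gt_eqF.
move=> z zw; have Hz : half_plane z.
  have zw0 : disc w `|side 0 w| z.
    by apply: lt_le_trans zw _; rewrite ge_min lexx orbT.
  have [_] := side_sign_disc zw0.
  by rewrite /half_plane /= !side0 !oppr_lt0 [0 < complex.Im w]Hw.
split=> // j.
have eqs i : ((arg z < gam i) = (arg w < gam i)) /\ ((gam i < arg z) = (gam i < arg w)).
  wlog id : i / (i <= d)%N.
    have [|di H] := leqP i d; first by move=> ? /(_ i); apply.
    by rewrite (cone_end_last (ltnW di)) -(cone_end_last (leqnn d)); exact: H.
  have gi := cone_end_in i; rewrite -!side_gt0 // -!side_lt0 //.
  apply: side_sign_disc; apply: lt_le_trans zw _.
  by rewrite ge_min He.
have az := half_plane_arg Hz; have aw := half_plane_arg Hw.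
split=> -[_ zj]; split=> //; first exact: sector_eq zj.
by apply: sector_eq zj => // i; have [-> ->] := eqs i.
Qed.

Lemma exchange_outer z : half_plane z ->
  arg z < beta alpha \/ pi - beta alpha < arg z -> exchange alpha tau z = z.
Proof.
move=> Hz out; rewrite /exchange; case: pickP => // j /asboolP[_ /sector_bounds].
have /andP[g1 _] := cone_end_bounds j; have /andP[_ g2] := cone_end_bounds j.+1.
by move=> /andP[h1 h2]; exfalso; case: out; lra.
Qed.

Lemma TCE_right z : half_plane z -> 0 < side (beta alpha) z -> F z = z - 1.
Proof.
have /andP[b0 bpi] := beta_bounds.
move=> Hz; rewrite side_gt0 // => [sz|]; last by apply/andP; split; lra.
rewrite /TCE exchange_outer /translation; [|by []|by left].
case: asboolP => // -[]; split=> //; rewrite /sector /= in_itv /= sz andbT.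
by have /andP[/ltW] := half_plane_arg Hz.
Qed.

Lemma TCE_left z : half_plane z -> side (pi - beta alpha) z < 0 ->
  F z = z + lambda%:C.
Proof.
have /andP[b0 bpi] := beta_bounds.
move=> Hz; rewrite side_lt0 // => [sz|]; last by apply/andP; split; lra.
rewrite /TCE exchange_outer /translation; [|by []|by right].
case: asboolP => [[_]|_]; first by rewrite /sector /= in_itv /= => /andP[_ zb]; exfalso; lra.
case: asboolP => // -[]; split=> //; rewrite /sector /= eqSS (gtn_eqF d_gt0) ltnn.
by have /andP[_ /ltW] := half_plane_arg Hz; rewrite /= in_itv /= sz.
Qed.

(** The hypotheses on [w] keep the rotated point among the middle cones, so that
    the translation is by [- eta]. *)
Lemma TCE_middle (j : 'I_d) z : half_plane z ->
  side (gam j) z < 0 -> 0 < side (gam j.+1) z ->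
  let w := z * expi (theta alpha tau j) in
  side (beta alpha) w < 0 -> 0 < side (pi - beta alpha) w ->
  F z = w - eta%:C.
Proof.
have /andP[b0 bpi] := beta_bounds.
have bI : 0 < beta alpha < pi by apply/andP; split; lra.
have bI' : 0 < pi - beta alpha < pi by apply/andP; split; lra.
move=> Hz s1 s2 w w1 w2; rewrite side_lt0 // ?cone_end_in // in s1.
rewrite side_gt0 // ?cone_end_in // in s2.
rewrite /TCE /exchange; case: pickP => [i /asboolP[_ /sector_bounds/andP[i1 i2]]|]; last first.
  by move=> /(_ j) /asboolP[]; split=> //; apply: sector_in; rewrite s1.
have -> : i = j.
  apply/val_inj/eqP; rewrite eqn_leq; apply/andP; split; rewrite leqNgt; apply/negP => ij.
    by have := cone_end_mono ij; lra.
  by have := cone_end_mono ij; lra.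
rewrite -/w /translation; case: asboolP => [[Hw]|_].
  rewrite /sector /= in_itv /= => /andP[_]; rewrite -side_gt0 // => wb; exfalso; lra.
case: asboolP => // -[Hw]; rewrite /sector /= eqSS (gtn_eqF d_gt0) ltnn /= in_itv /=.
by rewrite -side_lt0 // => /andP[wb _]; exfalso; lra.
Qed.

End Cones.

(** * Local rigidity of the map *)

Section RigidTCE.
Variables (R : realType) (d : nat) (alpha : 'rV[R]_d) (tau : 'S_d).
Variables (lambda eta : R).
Hypothesis d_gt0 : (0 < d)%N.
Hypothesis alphaP : cone_angles alpha.
Notation gam := (cone_end alpha).
Notation F := (TCE alpha tau lambda eta).

Lemma normc_expi (t : R) : normc (expi t) = 1.
Proof. by rewrite /= cos2Dsin2 sqrtr1. Qed.

Lemma rigid_at_near w u e : half_plane w -> (forall i, side (gam i) w != 0) ->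
  normc u = 1 -> 0 < e ->
  (forall z, disc w e z -> half_plane z -> F z = F w + u * (z - w)) ->
  exists2 e, 0 < e & rigid_at alpha F e w.
Proof.
move=> Hw /(cone_disc alphaP Hw)[e' e'0 He'] u1 e0 He.
exists (Num.min e e'); first by rewrite lt_min e0.
exists u => // z zw; have [|Hz zj] := He' z.
  by apply: lt_le_trans zw _; rewrite ge_min lexx orbT.
by split=> //; apply: He => //; apply: lt_le_trans zw _; rewrite ge_min lexx.
Qed.

Lemma rigid_right w : half_plane w -> 0 < side (beta alpha) w ->
  exists2 e, 0 < e & rigid_at alpha F e w.
Proof.
have /andP[b0 bpi] := beta_bounds alphaP; move=> Hw sw.
have bI : 0 < beta alpha < pi by apply/andP; split; lra.
apply: (@rigid_at_near _ 1 `|side (beta alpha) w|) => //.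
- move=> i; rewrite gt_eqF // side_gt0 ?cone_end_in //.
  have /andP[g _] := cone_end_bounds alphaP i.
  by apply: lt_le_trans g; rewrite -side_gt0.
- exact: normc1.
- by rewrite normr_gt0 gt_eqF.
- move=> z /side_sign_disc[zw _] Hz; rewrite !TCE_right // ?zw //.
  by rewrite mul1r addrAC addrCA subrr addr0.
Qed.

Lemma rigid_left w : half_plane w -> side (pi - beta alpha) w < 0 ->
  exists2 e, 0 < e & rigid_at alpha F e w.
Proof.
have /andP[b0 bpi] := beta_bounds alphaP; move=> Hw sw.
have bI : 0 < pi - beta alpha < pi by apply/andP; split; lra.
apply: (@rigid_at_near _ 1 `|side (pi - beta alpha) w|) => //.
- move=> i; rewrite lt_eqF // side_lt0 ?cone_end_in //.
  have /andP[_ g] := cone_end_bounds alphaP i.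
  by apply: le_lt_trans g _; rewrite -side_lt0.
- exact: normc1.
- by rewrite normr_gt0 lt_eqF.
- move=> z /side_sign_disc[_ zw] Hz; rewrite !TCE_left // ?zw //.
  by rewrite mul1r addrAC addrCA subrr addr0.
Qed.

Lemma rigid_middle (j : 'I_d) w : half_plane w ->
  side (gam j) w < 0 -> 0 < side (gam j.+1) w ->
  let u := expi (theta alpha tau j) in
  side (beta alpha) (w * u) < 0 -> 0 < side (pi - beta alpha) (w * u) ->
  exists2 e, 0 < e & rigid_at alpha F e w.
Proof.
move=> Hw s1 s2 u s3 s4.
have [|[|[|[|[|r]]]] //= _|e e0 He] := @common_radius R
    (fun i e => e <= `|nth 0 [:: side (gam j) w; side (gam j.+1) w;
       side (beta alpha) (w * u); side (pi - beta alpha) (w * u)] i|) 4.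
- by move=> r x y; exact: le_trans.
- by exists `|side (gam j) w|; rewrite // normr_gt0 lt_eqF.
- by exists `|side (gam j.+1) w|; rewrite // normr_gt0 gt_eqF.
- by exists `|side (beta alpha) (w * u)|; rewrite // normr_gt0 lt_eqF.
- by exists `|side (pi - beta alpha) (w * u)|; rewrite // normr_gt0 gt_eqF.
apply: (@rigid_at_near _ u e) => //; last 1 first.
- move=> z zw Hz.
  have zwu : disc (w * u) e (z * u) by rewrite /disc /= -mulrBl normcM normc_expi mulr1.
  have [_ z1] := side_sign_disc (lt_le_trans zw (He 0%N isT)).
  have [z2 _] := side_sign_disc (lt_le_trans zw (He 1%N isT)).
  have [_ z3] := side_sign_disc (lt_le_trans zwu (He 2%N isT)).
  have [z4 _] := side_sign_disc (lt_le_trans zwu (He 3%N isT)).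
  rewrite !(@TCE_middle _ _ _ _ _ _ _ _ j) // ?z1 ?z2 ?z3 ?z4 //.
  by rewrite -/u; ring.
- move: s1 s2; rewrite side_lt0 ?cone_end_in // side_gt0 ?cone_end_in // => s1 s2 i.
  have [ij|ji] := leqP i j.
    by rewrite lt_eqF // side_lt0 ?cone_end_in // (le_lt_trans _ s1) // cone_end_mono.
  by rewrite gt_eqF // side_gt0 ?cone_end_in // (lt_le_trans s2) // cone_end_mono.
- exact: normc_expi.
Qed.

End RigidTCE.

(** * Partial sums of the angles *)

Section Sums.
Variables (R : realType) (d : nat) (alpha : 'rV[R]_d) (tau : 'S_d) (j : 'I_d).

Lemma total_around : total alpha = alpha 0 j
  + \sum_(i < d | (tau i < tau j)%N) alpha 0 i
  + \sum_(i < d | (tau j < tau i)%N) alpha 0 i.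
Proof.
rewrite /total (bigD1 j) //= (bigID (fun i => (tau i < tau j)%N)) /= -addrA.
by congr (_ + (_ + _)); apply: eq_bigl => i; rewrite -(inj_eq (@perm_inj _ tau));
  rewrite -val_eqE /=; case: ltngtP.
Qed.

Lemma cone_endS : cone_end alpha j.+1 = cone_end alpha j + alpha 0 j.
Proof.
rewrite /cone_end.
have -> : \sum_(i < d | (i < j.+1)%N) alpha 0 i =
    \sum_(i < d | (i < j)%N) alpha 0 i + alpha 0 j; last by rewrite addrA.
rewrite (bigD1 j) //= addrC; congr (_ + _); apply: eq_bigl => i.
by rewrite ltnS -val_eqE /=; case: ltngtP.
Qed.

Hypothesis alphaP : cone_angles alpha.

Lemma partial_sum_ge0 (P : pred 'I_d) : 0 <= \sum_(i < d | P i) alpha 0 i.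
Proof. by apply: sumr_ge0 => i _; apply/ltW/alphaP.1. Qed.

Lemma theta_lt_total : `|theta alpha tau j| < total alpha.
Proof.
have aj := alphaP.1 j; have tE := total_around.
have tE' : total alpha = alpha 0 j + \sum_(i < d | (i < j)%N) alpha 0 i
    + \sum_(i < d | (j < i)%N) alpha 0 i.
  rewrite /total (bigD1 j) //= (bigID (fun i : 'I_d => (i < j)%N)) /= -addrA.
  by congr (_ + (_ + _)); apply: eq_bigl => i; rewrite -val_eqE /=; case: ltngtP.
have p1 := partial_sum_ge0 (fun i => (tau i < tau j)%N).
have p2 := partial_sum_ge0 (fun i => (tau j < tau i)%N).
have p3 := partial_sum_ge0 (fun i : 'I_d => (i < j)%N).
have p4 := partial_sum_ge0 (fun i : 'I_d => (j < i)%N).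
by rewrite ltr_norml /theta; apply/andP; split; lra.
Qed.

(** The points that the rotation of angle [theta_j] maps to their mirror images
    have argument [pi / 2 - theta_j / 2]. *)
Lemma reflective_atE : reflective_at alpha tau j <->
  cone_end alpha j < pi / 2 - theta alpha tau j / 2 < cone_end alpha j.+1.
Proof.
have tE := total_around; rewrite cone_endS /reflective_at /cone_end /beta /theta ltr_norml.
by split=> /andP[h1 h2]; apply/andP; split; lra.
Qed.

End Sums.

(** * Horizontal periodic orbits *)

Section HorizontalOrbit.
Variables (R : realType) (d : nat) (alpha : 'rV[R]_d) (tau : 'S_d) (k : nat).
Variable j : 'I_d.
Notation Phi := (golden R).
Notation gam := (cone_end alpha).
Let lambda : R := 1 / (k%:R + Phi).
Let eta : R := 1 - k%:R * lambda.
Notation F := (TCE alpha tau lambda eta).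
Let S : R := total alpha / 2.
Let y : R := theta alpha tau j / 2.

Hypothesis d_gt0 : (0 < d)%N.
Hypothesis k_gt0 : (0 < k)%N.
Hypothesis alphaP : cone_angles alpha.
Hypothesis reflj : reflective_at alpha tau j.
Hypothesis dominant : sin S * cos y <= 4 * `|sin y| * cos S.

Variables (N Q : nat).
Let T : R := (N%:R - Q%:R * Phi) / 2.
Let h : R := lambda * T * cos y / sin y.
Hypothesis Ty : 0 < T * sin y.
Hypothesis N0 : (0 < N)%N.
Hypothesis Q0 : (0 < Q)%N.
Hypothesis unimod :
  (N%:Z * N%:Z + N%:Z * Q%:Z - Q%:Z * Q%:Z) ^+ 2 = 1 :> int.
Hypothesis Tsmall : - Phi < 2 * T < Phi.

(* Abscissas are counted in the unit [lambda]; [T] is the abscissa of the point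
   of height [h] that is mirrored. *)
Let at_height (X : R) : R[i] := (lambda * X) +i* h.

Let y_lt : `|y| < S.
Proof.
rewrite /y /S normrM [`|2^-1|]gtr0_norm ?invr_gt0 //.
by rewrite ltr_pM2r ?invr_gt0 // theta_lt_total.
Qed.

Let S_bounds : 0 < S < pi / 2.
Proof. by have [_ /andP[t0 tpi]] := alphaP; rewrite /S; apply/andP; split; lra. Qed.

Let y_bounds : - (pi / 2) < y < pi / 2.
Proof. by have /andP[_ S1] := S_bounds; rewrite -ltr_norml (lt_trans y_lt). Qed.

Let cosy_gt0 : 0 < cos y. Proof. exact: cos_gt0_pihalf y_bounds. Qed.

Let siny_neq0 : sin y != 0.
Proof. by apply/eqP => y0; move: Ty; rewrite y0 mulr0 ltxx. Qed.

Let lambdaE : lambda * (k%:R + Phi) = 1.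
Proof.
have /andP[P1 P2] := golden_bounds R.
have k1 : 1 <= k%:R :> R by rewrite ler1n.
by rewrite /lambda mul1r mulVf // gt_eqF //; lra.
Qed.

Let lambda_gt0 : 0 < lambda.
Proof.
have /andP[P1 P2] := golden_bounds R.
have k1 : 1 <= k%:R :> R by rewrite ler1n.
by rewrite divr_gt0 //; lra.
Qed.

(* The modulus of the mirrored point, whose argument is [pi / 2 - y]. *)
Let rho : R := lambda * (T / sin y).

Let rho_gt0 : 0 < rho.
Proof.
rewrite mulr_gt0 // -(pmulr_lgt0 _ (_ : 0 < sin y ^+ 2)) ?exprn_even_gt0 //.
by rewrite expr2 mulrA divfK.
Qed.

Let hE : h = rho * cos y. Proof. by rewrite /h /rho; field. Qed.

Let h_gt0 : 0 < h. Proof. by rewrite hE mulr_gt0. Qed.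

Let half_at X : half_plane (at_height X). Proof. exact: h_gt0. Qed.

Let at_heightT : at_height T = (rho * sin y) +i* (rho * cos y).
Proof. by rewrite /at_height hE; congr (_ +i* _); rewrite /rho; field. Qed.

Let reflected : at_height T * expi (theta alpha tau j) = at_height (- T).
Proof.
have -> : theta alpha tau j = y + y by rewrite /y; field.
have -> : at_height (- T) = (- (rho * sin y)) +i* (rho * cos y).
  by rewrite /at_height hE; congr (_ +i* _); rewrite /rho; field.
rewrite at_heightT; have cs : cos y * cos y = 1 - sin y * sin y.
  by have := cos2Dsin2 y; rewrite !expr2 => <-; ring.
apply/eqP; rewrite eq_complex /= cosD sinD; apply/andP; split; apply/eqP; ring: cs.
Qed.

Let side_T g : side g (at_height T) = - rho * cos (g + y).
Proof. by rewrite at_heightT /side /= cosD; ring. Qed.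

Let side_NT g : side g (at_height (- T)) = - rho * cos (g - y).
Proof.
have -> : at_height (- T) = (- (rho * sin y)) +i* (rho * cos y).
  by rewrite /at_height hE; congr (_ +i* _); rewrite /rho; field.
by rewrite /side /= cosB; ring.
Qed.

Let before_mirror g : 0 < g < pi -> g + y < pi / 2 -> side g (at_height T) < 0.
Proof.
have /andP[y1 y2] := y_bounds.
move=> /andP[g0 gpi] gy; rewrite side_T mulNr oppr_lt0 mulr_gt0 // cos_gt0_pihalf //.
by apply/andP; split; lra.
Qed.

Let cos_lt0 (x : R) : pi / 2 < x < pi + pi / 2 -> cos x < 0.
Proof.
move=> /andP[x1 x2]; rewrite -oppr_gt0 -sinBpihalf sin_gt0_pi //.
by apply/andP; split; lra.
Qed.

Let after_mirror g : 0 < g < pi -> pi / 2 < g + y -> 0 < side g (at_height T).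
Proof.
have /andP[y1 y2] := y_bounds.
move=> /andP[g0 gpi] gy; rewrite side_T mulNr oppr_gt0 pmulr_rlt0 // cos_lt0 //.
by apply/andP; split; lra.
Qed.

Let betaE : beta alpha = pi / 2 - S. Proof. by []. Qed.

(* A point of the orbit with [4 |T| < |X|] lies in an outer cone. *)
Let height_dominated : h * sin S <= 4 * (lambda * `|T|) * cos S.
Proof.
have q0 : 0 < T / sin y by rewrite -(pmulr_rgt0 _ lambda_gt0).
have -> : `|T| = T / sin y * `|sin y|.
  by rewrite -[X in X * _](gtr0_norm q0) -normrM divfK.
rewrite hE /rho; move: dominant; rewrite -(ler_pM2l rho_gt0) /rho => dom.
rewrite [leLHS](_ : _ = lambda * (T / sin y) * (sin S * cos y)); last by ring.
by apply: le_trans dom _; rewrite le_eqVlt; apply/orP; left; apply/eqP; ring.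
Qed.

Let sin_beta : sin (beta alpha) = cos S.
Proof. by rewrite betaE sinB sin_pihalf cos_pihalf; ring. Qed.

Let cos_beta : cos (beta alpha) = sin S.
Proof. by rewrite betaE cosB sin_pihalf cos_pihalf; ring. Qed.

Let cosS_gt0 : 0 < cos S.
Proof.
have /andP[S0 S1] := S_bounds.
by rewrite cos_gt0_pihalf //; apply/andP; split; lra.
Qed.

Let side_right X : 4 * `|T| < X -> 0 < side (beta alpha) (at_height X).
Proof.
move=> TX; rewrite /side sin_beta cos_beta /= subr_gt0.
apply: le_lt_trans height_dominated _.
by rewrite ltr_pM2r // mulrCA ltr_pM2l.
Qed.

Let side_left X : 4 * `|T| < - X -> side (pi - beta alpha) (at_height X) < 0.
Proof.
move=> TX.
have -> : side (pi - beta alpha) (at_height X) = h * sin S - lambda * (- X) * cos S.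
  by rewrite /side sinB cosB sin_beta cos_beta sinpi cospi /=; ring.
rewrite subr_lt0.
apply: le_lt_trans height_dominated _.
by rewrite ltr_pM2r // mulrCA ltr_pM2l.
Qed.

Lemma at_height_step X : 4 * `|T| < `|X| ->
  F (at_height X) = at_height (rotation k X) /\
  exists2 e, 0 < e & rigid_at alpha F e (at_height X).
Proof.
rewrite /rotation; case: (ltP X 0) => X0.
  rewrite (ltr0_norm X0) => /side_left sX; split; last exact: rigid_left.
  by rewrite TCE_left // /at_height; apply/eqP; rewrite eq_complex /= addr0 mulrDr mulr1 !eqxx.
rewrite (ger0_norm X0) => /side_right sX; split; last exact: rigid_right.
rewrite TCE_right // /at_height; apply/eqP; rewrite eq_complex /= subr0 eqxx andbT.
by rewrite mulrBr lambdaE.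
Qed.

Lemma at_height_mirror : F (at_height T) = at_height (- Phi - T) /\
  exists2 e, 0 < e & rigid_at alpha F e (at_height T).
Proof.
have [/(_ reflj) /andP[g1 g2] _] := reflective_atE alpha tau j.
have /andP[S0 S1] := S_bounds; have /andP[b0 b1] := beta_bounds alphaP.
have s1 : side (gam j) (at_height T) < 0.
  by apply: before_mirror; [exact: cone_end_in | rewrite -ltrBrDr].
have s2 : 0 < side (gam j.+1) (at_height T).
  by apply: after_mirror; [exact: cone_end_in | rewrite -ltrBlDr].
have /andP[y1 y2] : - S < y < S by rewrite -ltr_norml.
have s3 : side (beta alpha) (at_height T * expi (theta alpha tau j)) < 0.
  rewrite reflected side_NT mulNr oppr_lt0 mulr_gt0 // cos_gt0_pihalf //.
  by rewrite betaE; apply/andP; split; lra.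
have s4 : 0 < side (pi - beta alpha) (at_height T * expi (theta alpha tau j)).
  rewrite reflected side_NT mulNr oppr_gt0 pmulr_rlt0 // cos_lt0 //.
  by rewrite betaE; apply/andP; split; lra.
split; last exact: rigid_middle s3 s4.
rewrite (@TCE_middle _ _ _ _ _ _ d_gt0 alphaP j) // reflected /at_height.
apply/eqP; rewrite eq_complex /= subr0 eqxx andbT; apply/eqP; rewrite /eta.
by rewrite -[X in _ - (X - _)]lambdaE; ring.
Qed.

(** The period is minimal because all points of the orbit but the mirrored one
    have an abscissa larger than [4 |T|] in absolute value. *)
Lemma horizontal_rigid_orbit : exists m p,
  [/\ periodic_point F m p, 
      forall r, (r < m)%N -> complex.Im (iter r F p) = h &
      forall r, (r < m)%N -> exists2 e, 0 < e & rigid_at alpha F e (iter r F p)].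
Proof.
have T0 : T != 0 by apply/eqP => T0; move: Ty; rewrite T0 mul0r ltxx.
have [s [sT sM]] : exists s, iter s (rotation k) (- Phi - T) = T /\
    forall i, (i < s)%N -> 4 * `|T| < `|iter i (rotation k) (- Phi - T)|.
  apply: (@rotation_return _ _ N Q) => // n q qQ nq.
  exact: golden_gap.
have orb i : (i <= s)%N ->
    iter i.+1 F (at_height T) = at_height (iter i (rotation k) (- Phi - T)).
  elim: i => [_|i IH si]; first exact: at_height_mirror.1.
  by rewrite iterS IH 1?ltnW // (at_height_step (sM i si)).1.
exists s.+1, (at_height T); split.
- split=> //; first by rewrite orb // sT.
  move=> [//|i] /= si; rewrite -iterS orb 1?ltnW // => -[] /(mulfI (lt0r_neq0 lambda_gt0)) iT.
  by have := sM i si; rewrite iT; have := normr_ge0 T; lra.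
- by move=> [|r] // rs; rewrite orb // ltnW.
- move=> [|r] rs; first exact: at_height_mirror.2.
  by rewrite orb 1?ltnW //; apply: (at_height_step (sM r rs)).2.
Qed.

End HorizontalOrbit.

(** * Islands at all small heights *)

(** This is [tan S <= 4 |tan y|].  As [S < 2 |y|], it follows from
    [sin S <= sin (2 |y|)] and from [1 / 2 <= cos S]. *)
Lemma half_angle_domination (R : realType) (S y : R) :
  0 < S < pi / 4 -> `|y| < S < 2 * `|y| ->
  sin S * cos y <= 4 * `|sin y| * cos S.
Proof.
wlog y0 : y / 0 <= y => [hw|].
  have [|/ltW y0 S0 yS] := leP 0 y; first exact: hw.
  by rewrite -cosN -[`|sin y|]normrN -sinN; apply: hw; rewrite ?oppr_ge0 ?normrN.
rewrite (ger0_norm y0) => /andP[S0 S4] /andP[yS Sy].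
have cS2 : 0 < cos (S *+ 2).
  by rewrite mulr2n cos_gt0_pihalf //; apply/andP; split; lra.
have cS : 0 < cos S by rewrite cos_gt0_pihalf //; apply/andP; split; lra.
have cy : 0 < cos y by rewrite cos_gt0_pihalf //; apply/andP; split; lra.
have sy : 0 < sin y by rewrite sin_gt0_pi //; apply/andP; split; lra.
have sS : sin S <= sin (y *+ 2).
  have yI : y *+ 2 \in `[- (pi / 2), pi / 2]%R.
    by rewrite in_itv /= (mulr2n y); apply/andP; split; lra.
  have SI : S \in `[- (pi / 2), pi / 2]%R.
    by rewrite in_itv /=; apply/andP; split; lra.
  by rewrite ltW // ltr_sin // (mulr2n y); lra.
rewrite cos_mulr2n in cS2; rewrite sin_mulr2n in sS; rewrite (gtr0_norm sy).
have cS1 : 1 / 2 <= cos S by nra.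
have cy1 : cos y * cos y <= 1 by have := cos_le1 y; nra.
apply: (@le_trans _ _ (2 * (sin y * (cos y * cos y)))).
  by rewrite mulrCA mulrA mulrAC; nra.
nra.
Qed.

Section Cluster.
Variables (R : realType) (d : nat) (alpha : 'rV[R]_d) (tau : 'S_d) (k : nat).
Variable j : 'I_d.
Notation Phi := (golden R).
Let lambda : R := 1 / (k%:R + Phi).
Let eta : R := 1 - k%:R * lambda.
Notation F := (TCE alpha tau lambda eta).

Hypothesis d_gt0 : (0 < d)%N.
Hypothesis k_gt0 : (0 < k)%N.
Hypothesis alphaP : cone_angles alpha.
Hypothesis reflj : reflective_at alpha tau j.
Hypothesis total_lt : total alpha < pi / 2.
Hypothesis theta_large : total alpha < 2 * `|theta alpha tau j|.

(** Each step multiplies the height by [Phi ^ 2], the parity of the Fibonacci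
    index being fixed by the sign of [theta_j].  The radii are at most half the
    height, so that islands of different heights are different sets. *)
Lemma island_family : exists2 c : R, 0 < c & forall n, exists I O : set R[i],
  [/\ periodic_island F alpha I,
      horizontal_periodic_orbit F (c * (Phi * Phi) ^+ n) O,
      O `<=` I, O !=set0 &
      forall z, I z -> `|complex.Im z - c * (Phi * Phi) ^+ n| < c * (Phi * Phi) ^+ n / 2].
Proof.
have /andP[P1 P2] := golden_bounds R.
have P0 : 0 < Phi by lra.
have Plt1 : Phi < 1 by lra.
pose y := theta alpha tau j / 2.
have [_ /andP[t0 tpi]] := alphaP.
have yE : `|y| = `|theta alpha tau j| / 2.
  by rewrite /y normrM [`|2^-1|]gtr0_norm ?invr_gt0.
have thlt := theta_lt_total tau j alphaP.
have tot_lt := total_lt; have th_large := theta_large.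
have y_gt0 : 0 < `|y| by rewrite yE; lra.
have ypi : `|y| < pi / 4 by rewrite yE; lra.
have dom : sin (total alpha / 2) * cos y <= 4 * `|sin y| * cos (total alpha / 2).
  by apply: half_angle_domination; rewrite ?yE; apply/andP; split; lra.
have cy : 0 < cos y.
  by rewrite cos_gt0_pihalf // -ltr_norml; lra.
have sy : sin y != 0.
  apply/eqP => sy0; move: dom; rewrite sy0 normr0 mulr0 mul0r.
  have := @sin_gt0_pi R (total alpha / 2); rewrite leNgt => H /negP; apply.
  by rewrite mulr_gt0 // H //; apply/andP; split; lra.
have l0 : 0 < lambda.
  have k1 : 1 <= k%:R :> R by rewrite ler1n.
  by rewrite divr_gt0 //; lra.
(* [b] adjusts the parity of the Fibonacci index, which governs the sign of [T]. *)
pose b : bool := sin y < 0.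
pose c := lambda * (Phi ^+ (2 + b) / 2) * cos y / `|sin y|.
have c0 : 0 < c.
  by rewrite divr_gt0 ?normr_gt0 // mulr_gt0 // mulr_gt0 // divr_gt0 ?exprn_gt0.
exists c => // n.
pose m := (n.*2.+1 + b)%N.
pose T : R := ((fib m)%:R - (fib m.+1)%:R * Phi) / 2.
have TE : T = (-1) ^+ b * Phi ^+ (n.*2 + (2 + b)) / 2.
  have mE : m.+1 = (n.*2 + (2 + b))%N by rewrite /m addnA addn2 !addSn.
  have sE : (-1) ^+ (n.*2 + (2 + b)) = (-1) ^+ b :> R.
    by rewrite !exprD -mul2n exprM sqrrN !expr1n !mul1r.
  by rewrite /T fib_golden mE (exprNn Phi) sE.
have sgn : (-1) ^+ b * `|sin y| = sin y.
  rewrite /b; have [s0|s0] := ltP (sin y) 0.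
    by rewrite ltr0_norm // expr1 mulN1r opprK.
  by rewrite ger0_norm // expr0 mul1r.
have sgn2 : (-1) ^+ b * (-1) ^+ b = 1 :> R by rewrite -signr_addb addbb.
have sgn' : (-1) ^+ b * sin y = `|sin y| by rewrite -[in LHS]sgn mulrA sgn2 mul1r.
have hE : lambda * T * cos y / sin y = c * (Phi * Phi) ^+ n.
  have sV : ((-1) ^+ b)^-1 = (-1) ^+ b :> R.
    by apply/(mulfI (_ : (-1) ^+ b != 0)); rewrite ?signr_eq0 // sgn2 mulfV ?signr_eq0.
  rewrite /c -sgn' invfM sV TE exprD -mul2n exprM expr2.
  move: ((-1) ^+ b) ((Phi * Phi) ^+ n) (Phi ^+ (2 + b)) (sin y)^-1 (cos y) lambda.
  by move=> *; ring.
have Ty : 0 < T * sin y.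
  rewrite TE mulrAC [_ * sin y]mulrAC sgn' !mulr_gt0 ?normr_gt0 ?exprn_gt0 ?invr_gt0 //.
have Tsmall : - Phi < 2 * T < Phi.
  rewrite -ltr_norml TE [2 * _]mulrC divfK // normrM normr_sign mul1r.
  have e1 : (1 < n.*2 + (2 + b))%N by rewrite addnA addn2 !addSn.
  by rewrite gtr0_norm ?exprn_gt0 // -[ltRHS]expr1 ltr_iXn2l.
have [m' [p [per hor rig]]] := @horizontal_rigid_orbit R d alpha tau k j d_gt0
  k_gt0 alphaP reflj dom (fib m) (fib m.+1) Ty (fibS_gt0 _) (fibS_gt0 _)
  (cassini m) Tsmall.
have [_ m'0 _ _] := per.
have [e0 e00 He0] := periodic_island_of_rigid per rig.
rewrite -/T -/lambda -/y hE in hor.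
set hn := c * _ in hor *.
have hn0 : 0 < hn by rewrite mulr_gt0 // exprn_gt0 // mulr_gt0.
pose e := Num.min e0 (hn / 2).
have e_gt0 : 0 < e by rewrite lt_min e00 divr_gt0.
exists (\bigcup_(r in `I_m') disc (iter r F p) e), [set iter r F p | r in `I_m'].
split.
- by apply: He0; rewrite e_gt0 ge_min lexx.
- split; first by exists m', p.
  by move=> _ [r rm <-]; exact: hor.
- by move=> _ [r rm <-]; exists r => //; rewrite /disc /= subrr normc0.
- by exists p, 0%N.
- move=> z [r rm zr]; rewrite -{1}(hor r rm).
  have lip : `|complex.Im z - complex.Im (iter r F p)| <= normc (z - iter r F p).
    by have := side_lip 0 z (iter r F p); rewrite !side0 opprK addrC distrC.
  have e_le : e <= hn / 2 by rewrite ge_min lexx orbT.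
  exact: le_lt_trans lip (lt_le_trans zr e_le).
Qed.

Lemma horizontal_islands_of_admissible_angles :
  horizontal_islands_cluster_at_real_line F alpha.
Proof.
have /andP[P1 P2] := golden_bounds R; have PP := golden_sqr R.
have [c c0 fam0] := island_family.
have [I famI] := choice fam0; have [Orb fam] := choice famI.
have r0 : 0 < Phi * Phi by rewrite PP; lra.
have r1 : Phi * Phi < 1 / 2 by rewrite PP; lra.
pose h n := c * (Phi * Phi) ^+ n.
have h0 n : 0 < h n by rewrite mulr_gt0 // exprn_gt0.
(* [Phi ^ 2 < 1 / 2], so the later orbits are below the earlier islands. *)
have hlt n m : (n < m)%N -> h m < h n / 2.
  move=> nm; have : h m <= h n.+1.
    by rewrite ler_pM2l // ler_wiXn2l // ltW // (lt_trans r1) //; lra.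
  have -> : h n.+1 = Phi * Phi * h n by rewrite /h exprS mulrCA.
  move: (Phi * Phi) r1 (h n) (h0 n) (h m) => r r1 u u0 v vu.
  apply: le_lt_trans vu _; nra.
exists I, Orb, h; split.
- have sep n m : (n < m)%N -> I n <> I m.
    move=> nm eqI; have [_ _ _ _ near] := fam n.
    have [_ [_ hor] OI [z Oz] _] := fam m.
    have := near z; rewrite eqI => /(_ (OI _ Oz)); rewrite (hor _ Oz) -/(h n) -/(h m).
    by rewrite ltr_norml => /andP[h1 _]; have := hlt _ _ nm; lra.
  move=> n m eqI; have [nm|mn|//] := ltngtP n m.
    by case: (sep _ _ nm).
  by case: (sep _ _ mn).
- by move=> n; have [] := fam n.
- by move=> n; have [] := fam n.
- by move=> n; have [] := fam n.
- rewrite -(mulr0 c); apply: cvgMl_tmp; apply: cvg_expr.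
  by rewrite gtr0_norm //; lra.
Qed.

End Cluster.

(** * An open set of angles *)

Section Admissible.
Variables (R : realType) (d : nat) (tau : 'S_d) (j : 'I_d).

(** The bounds on [total] make the middle cones narrow with respect to the angle
    of rotation [theta_j]. *)
Definition admissible : set 'rV[R]_d := [set alpha : 'rV[R]_d |
  [/\ cone_angles alpha, reflective_at alpha tau j,
      total alpha < pi / 2 & total alpha < 2 * `|theta alpha tau j|]].

Lemma partial_sum_continuous (P : pred 'I_d) :
  continuous (fun alpha : 'rV[R]_d => \sum_(i < d | P i) alpha 0 i).
Proof.
apply: continuous_big => [|i _]; last exact: coord_continuous.
exact: add_continuous.
Qed.

Lemma near_lt (f g : 'rV[R]_d -> R) alpha : continuous f -> continuous g ->
  f alpha < g alpha -> \forall a \near alpha, f a < g a.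
Proof.
move=> cf cg fg; have : \forall a \near alpha, 0 < (g - f) a.
  by apply: (cvgr_gt _ (cvgB (cg alpha) (cf alpha))); rewrite subr_gt0.
by apply: filterS => a; rewrite /= subr_gt0.
Qed.

Lemma admissible_open : open admissible.
Proof.
rewrite openE => alpha [[apos /andP[t0 tpi]] refl t2 tth].
have cs (P : pred 'I_d) := @partial_sum_continuous P.
have ct : continuous (@total R d) by exact: cs.
have cn (P Q : pred 'I_d) : continuous (fun a : 'rV[R]_d =>
    `|\sum_(i < d | P i) a 0 i - \sum_(i < d | Q i) a 0 i|).
  by move=> a; exact: (cvg_norm (cvgB (cs P a) (cs Q a))).
have cc (c : R) : continuous (fun _ : 'rV[R]_d => c) by exact: cst_continuous.
have npos : \forall a \near alpha, forall i, 0 < (a : 'rV[R]_d) 0 i.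
  have cp i : \forall a \near alpha, 0 < (a : 'rV[R]_d) 0 i.
    by apply: (near_lt (cc 0) _ (apos i)); exact: coord_continuous.
  exact: (@filter_forall _ _ (fun i (a : 'rV[R]_d) => 0 < a 0 i) (nbhs alpha) _ cp).
have nt0 : \forall a \near alpha, 0 < total a := near_lt (cc 0) ct t0.
have ntpi : \forall a \near alpha, total a < pi := near_lt ct (cc pi) tpi.
have nt2 : \forall a \near alpha, total a < pi / 2 := near_lt ct (cc (pi / 2)) t2.
have nr : \forall a \near alpha, reflective_at a tau j.
  by apply: (near_lt (cn _ _) _ refl); exact: coord_continuous.
have ctheta : continuous (fun a : 'rV[R]_d => 2 * `|theta a tau j|).
  move=> a; have ca := cn (fun i => (tau i < tau j)%N) (fun i => (i < j)%N) a.
  exact: (cvgM (cc 2 a) ca).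
have nth : \forall a \near alpha, total a < 2 * `|theta a tau j| :=
  near_lt ct ctheta tth.
near=> a; split.
- split; first by near: a.
  by apply/andP; split; near: a.
- by near: a.
- by near: a.
- by near: a.
Unshelve. all: by end_near. Qed.

(** If [j'] has most of the total angle, then [theta_j] is nearly plus or minus
    that angle, since [j'] is counted in exactly one of its two sums.  In the
    condition of being reflective at [j] the angle of [j'] is counted in both
    sums or in none, and the angle of [j] outweighs those that remain. *)
Lemma admissible_nonempty (j' : 'I_d) : j' != j ->
  (j' < j)%N != (tau j' < tau j)%N -> admissible !=set0.
Proof.
move=> jj order; have d0 : (0 < d)%N by case: (d) j => [[]|].
have dR : 0 < d%:R :> R by rewrite ltr0n.
pose alpha : 'rV[R]_d := \row_i
  if i == j then 1 / 5 else if i == j' then 3 / 5 else 1 / (20 * d%:R).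
have apos i : 0 < alpha 0 i.
  by rewrite mxE; case: ifP => _; [|case: ifP => _]; rewrite divr_gt0 // mulr_gt0.
have aj : alpha 0 j = 1 / 5 by rewrite mxE eqxx.
have aj' : alpha 0 j' = 3 / 5 by rewrite mxE (negbTE jj) eqxx.
(* The angles other than those of [j] and [j'] add up to at most [1 / 20]. *)
have rest (P : pred 'I_d) : P j = false ->
    (P j')%:R * (3 / 5) <= \sum_(i < d | P i) alpha 0 i <= (P j')%:R * (3 / 5) + 1 / 20.
  move=> Pj.
  have -> : \sum_(i < d | P i) alpha 0 i =
      (P j')%:R * (3 / 5) + \sum_(i < d | P i && (i != j')) alpha 0 i.
    case Pj' : (P j'); first by rewrite (bigD1 j') //= aj' mul1r.
    rewrite mul0r add0r; apply: eq_bigl => i.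
    by case: eqP => [->|]; rewrite ?Pj' ?andbT.
  rewrite lerDl lerD2l sumr_ge0 => [/=|i _]; last exact: ltW.
  apply: (@le_trans _ _ (\sum_(i < d) 1 / (20 * d%:R))); last first.
    have -> : \sum_(i < d) 1 / (20 * d%:R) = 1 / 20 :> R; last by [].
    by rewrite sumr_const card_ord -[_ *+ d]mulr_natr; field; rewrite gt_eqF.
  rewrite big_mkcond; apply: ler_sum => i _; case: ifP => [/andP[Pi ij']|_].
    rewrite mxE (negbTE ij'); case: eqP => // ij; by rewrite ij Pj in Pi.
  by rewrite divr_ge0 // mulr_ge0 // ltW.
have tE := total_around alpha tau j; rewrite aj in tE.
have := rest (fun i => (tau i < tau j)%N); have := rest (fun i => (tau j < tau i)%N).
have := rest (fun i => (i < j)%N); rewrite !ltnn => /(_ erefl)/andP[l1 l2].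
move=> /(_ erefl)/andP[u1 u2] /(_ erefl)/andP[p1 p2].
have tauj : (tau j < tau j')%N = ~~ (tau j' < tau j)%N.
  have : tau j' != tau j by rewrite (inj_eq perm_inj).
  by rewrite -val_eqE /=; case: ltngtP.
have pi1 := pihalf_ge1 R.
have tpi : total alpha < pi / 2.
  rewrite tauj in u1 u2; move: u1 u2 p1 p2; case: (tau j' < tau j)%N => /=; lra.
exists alpha; split => //.
- split=> //; apply/andP; split; last by lra.
  by rewrite tE; move: u1 p1; do 2 case: (_ < _)%N => /=; lra.
- rewrite /reflective_at aj ltr_norml; move: order l1 l2 u1 u2; rewrite tauj.
  by case: (j' < j)%N; case: (tau j' < tau j)%N => //= _; lra.
- have : 1 / 2 <= `|theta alpha tau j|.
    rewrite /theta ler_normr; move: order l1 l2 p1 p2.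
    case: (j' < j)%N; case: (tau j' < tau j)%N => //= _; lra.
  move: u1 u2 p1 p2; rewrite tE tauj; case: (tau j' < tau j)%N => /=; lra.
Qed.

End Admissible.

Theorem theoremC (R : realType) (d : nat) (tau : 'S_d) (k : nat)
    (lambda eta : R) :
  (2 <= d)%N -> zeta R tau -> (1 <= k)%N ->
  lambda = 1 / (k%:R + golden R) -> eta = 1 - k%:R * lambda ->
  exists A : set 'rV[R]_d,
    [/\ A !=set0, open A,
        A `<=` @cone_angles R d `&` reflective tau
      & forall alpha, A alpha ->
          horizontal_islands_cluster_at_real_line (TCE alpha tau lambda eta) alpha].
Proof.
move=> d2 tau_zeta k1 -> ->.
have [j [j' [jj order]]] : exists j j' : 'I_d,
    j' != j /\ (j' < j)%N != (tau j' < tau j)%N.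
  case: tau_zeta => -[j [j' [_ jj tt]]]; exists j, j'.
    by split; [rewrite -val_eqE gtn_eqF | rewrite tt ltnNge (ltnW jj)].
  by split; [rewrite -val_eqE ltn_eqF | rewrite jj ltnNge (ltnW tt)].
exists (@admissible R d tau j); split.
- exact: admissible_nonempty order.
- exact: admissible_open.
- by move=> alpha [aP refl _ _]; split=> //; split=> //; exists j.
- move=> alpha [aP refl t2 tth].
  by apply: horizontal_islands_of_admissible_angles refl t2 tth => //; exact: ltnW.
Qed.
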